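(* Let $p$ be a prime, $R=\mathbb{Z}/p^2\mathbb{Z}$, $\tilde R=\mathrm{GR}(p^2,d)$ with $d\ge1$, and $F=\tilde R/p\tilde R$. Let $A\in R^{n\times n}$ have Smith form $\mathrm{diag}(1^{r_0},p^{r_1},0^{r_2})$, let $a=\mathrm{rank}_F(A\bmod p)$ and $k=n-a$. Suppose $A'$ is obtained from $A$ by invertible row and column operations over $\tilde R$ (i.e. $A'=PAQ$ with $P,Q\in\mathrm{GL}_n(\tilde R)$) and $$A'=\begin{bmatrix} B & C \\ D & E \end{bmatrix},\qquad B\in\tilde R^{a\times a},\quad B\bmod p\ \text{nonsingular}.$$ Let $J=E-DB^{-1}C\in\tilde R^{k\times k}$, which satisfies $J\equiv0\bmod p$, and let $T\in F^{k\times k}$ be the unique matrix with $J=pT$. Then $$r_1=\mathrm{rank}_F(T),\qquad r_2=k-\mathrm{rank}_F(T).$$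
   Context: $\mathrm{GR}(p^2,d)$ is the unramified Galois ring extension of $\mathbb{Z}/p^2\mathbb{Z}$ of degree $d$: a local ring with maximal ideal $p\tilde R$, $p^2=0$, residue field $F\cong\mathbb{F}_{p^d}$ ($d=1$ gives $R$). Multiplication by $p$ induces an isomorphism $F=\tilde R/p\tilde R\to p\tilde R$, $\bar x\mapsto px$; $pT$ for a matrix $T$ over $F$ means applying this isomorphism entrywise. The Smith form of $A$ over $R$ is the diagonal matrix $UAV=\mathrm{diag}(1^{r_0},p^{r_1},0^{r_2})$, $U,V\in\mathrm{GL}_n(R)$, where exponents denote the numbers of diagonal entries equal to $1$, $p$, $0$; the multiplicities are uniquely determined, and $A$ is regarded as a matrix over $\tilde R$ via $R\subseteq\tilde R$. *)

(* Defs.v *)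
From HB Require Import structures.
From mathcomp Require Import all_boot all_order all_algebra.
Set Implicit Arguments.
Unset Strict Implicit.
Unset Printing Implicit Defensive.
Import GRing.Theory.
Local Open Scope ring_scope.

(* Rt is GR(p^2, d), an extension of Z/p^2Z via iota, and F is its residue
   field Rt / p Rt, presented by its canonical projection red. Since iota is
   injective, Rt has characteristic p^2, which together with the other
   conditions determines Rt up to isomorphism. That Rt is local with maximal
   ideal p Rt is expressed by saying that the non-units are exactly the
   elements of p Rt. *)
Record is_galois_ring (p d : nat) (Rt : comUnitRingType) (F : finFieldType)
    (iota : {rmorphism 'Z_(p ^ 2) -> Rt}) (red : {rmorphism Rt -> F}) : Prop :=
  IsGaloisRing {
    gr_iota_inj : injective iota;
    gr_p_sqr : (p%:R : Rt) ^+ 2 = 0;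
    gr_local : forall x : Rt,
      x \isn't a GRing.unit <-> exists y, x = p%:R * y;
    gr_red_surj : forall y : F, exists x : Rt, red x == y;
    gr_red_ker : forall x : Rt, red x = 0 <-> exists y, x = p%:R * y;
    gr_card_residue : #|F| = (p ^ d)%N
  }.

(* The map F -> p Rt induced by multiplication by p; [mulp_red] shows that it
   does not depend on the chosen lift. *)
Definition mulp (p d : nat) (Rt : comUnitRingType) (F : finFieldType)
    (iota : {rmorphism 'Z_(p ^ 2) -> Rt}) (red : {rmorphism Rt -> F})
    (GR : is_galois_ring d iota red) (y : F) : Rt := p%:R * xchoose (gr_red_surj GR y).

Lemma mulp_red (p d : nat) (Rt : comUnitRingType) (F : finFieldType)
    (iota : {rmorphism 'Z_(p ^ 2) -> Rt}) (red : {rmorphism Rt -> F})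
    (GR : is_galois_ring d iota red) (x : Rt) :
  mulp GR (red x) = p%:R * x.
Proof.
apply/eqP; rewrite -subr_eq0 -mulrBr; apply/eqP.
have /eqP e := xchooseP (gr_red_surj GR (red x)).
have /(gr_red_ker GR)[y ->] : red (xchoose (gr_red_surj GR (red x)) - x) = 0.
  by rewrite rmorphB /= e subrr.
by rewrite mulrA -expr2 (gr_p_sqr GR) mul0r.
Qed.

(* diag(1^{r0}, p^{r1}, 0^{n - r0 - r1}) *)
Definition smith_diag (p n r0 r1 : nat) : 'M['Z_(p ^ 2)]_n :=
  diag_mx (\row_(i < n)
    if (i < r0)%N then 1 else if (i < r0 + r1)%N then p%:R else 0).

Definition has_smith_form (p n : nat) (A : 'M['Z_(p ^ 2)]_n)
    (r0 r1 r2 : nat) : Prop :=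
  n = (r0 + r1 + r2)%N /\
  exists U V : 'M['Z_(p ^ 2)]_n,
    [/\ U \in unitmx, V \in unitmx & U *m A *m V = smith_diag p n r0 r1].

(* Main.v *)
(* Let [S = UAV] be the Smith form. Reducing mod p gives [a = r0], and block
   elimination makes [A'] equivalent to [diag(1, J)]; hence
   [X diag(1, J) = diag(1, p I_{r1}) Y], writing [I_{r1}] for the k x k partial
   identity, with [X] and [Y] invertible. Comparing blocks, [X] mod p is block
   upper triangular and [Y] mod p block lower triangular, so their lower right
   blocks [X4], [Y4] are invertible mod p, while [X4 (p T) = p I_{r1} Y4].
   Cancelling p yields [X4 T = I_{r1} Y4] over F, so [rank T = r1]. *)
Require Import Defs.
From HB Require Import structures.
From mathcomp Require Import all_boot all_order all_algebra.
Set Implicit Arguments.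
Unset Strict Implicit.
Unset Printing Implicit Defensive.
Import GRing.Theory.
Local Open Scope ring_scope.

(** Block elimination with the pivot [B] kept inside the right factor: the outer factors are block
    triangular of determinants 1 and [\det B], hence invertible. *)
Lemma block_mx_schur (R : comUnitRingType) (a k : nat) (B : 'M[R]_a)
    (C : 'M_(a, k)) (D : 'M_(k, a)) (E : 'M_k) : B \in unitmx ->
  block_mx B C D E =
    block_mx 1%:M 0 (D *m invmx B) 1%:M
    *m block_mx 1%:M 0 0 (E - D *m invmx B *m C) *m block_mx B C 0 1%:M.
Proof.
move=> uB; rewrite !mulmx_block !mul1mx !mulmx1 !mulmx0 !mul0mx !addr0 !add0r.
by rewrite !mul1mx mulmxKV // addrC subrK.
Qed.

Lemma map_mx_unit (R S : comUnitRingType) (f : {rmorphism R -> S}) (n : nat)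
    (M : 'M[R]_n) : M \in unitmx -> map_mx f M \in unitmx.
Proof. by rewrite !unitmxE det_map_mx; apply: rmorph_unit. Qed.

Lemma mxrank_mulmx_unit (F : fieldType) (m n : nat) (X : 'M[F]_m)
    (Y : 'M_n) (M : 'M_(m, n)) : X \in unitmx -> Y \in unitmx ->
  \rank (X *m M *m Y) = \rank M.
Proof.
rewrite -row_full_unit => uX; rewrite -row_free_unit => uY.
by rewrite mxrankMfree //; have /eqmxMfull -> := uX.
Qed.

Lemma map_smith_diag (p n r0 r1 : nat) (R : nzRingType)
    (f : {rmorphism 'Z_(p ^ 2) -> R}) : p%:R = 0 :> R ->
  map_mx f (smith_diag p n r0 r1) = pid_mx r0.
Proof.
move=> p0; apply/matrixP=> i j; rewrite !mxE rmorphMn /= -(inj_eq val_inj) /=.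
case: (i == j :> nat) => //=; rewrite mulr1n.
by case: ifP => _; rewrite ?rmorph1 //; case: ifP; rewrite ?rmorph_nat ?p0 ?rmorph0.
Qed.

Lemma smith_diag_block (p a k r1 : nat) :
  smith_diag p (a + k) a r1 = block_mx 1%:M 0 0 (p%:R *: pid_mx r1).
Proof.
apply/matrixP=> i j; rewrite !mxE.
case: (splitP i) => i' ei; rewrite !mxE; case: (splitP j) => j' ej; rewrite !mxE.
- by rewrite -(inj_eq val_inj) /= ei ej.
- by rewrite -(inj_eq val_inj) /= ei ej ltn_eqF // (leq_trans (ltn_ord i')) ?leq_addr.
- by rewrite -(inj_eq val_inj) /= ei ej gtn_eqF // (leq_trans (ltn_ord j')) ?leq_addr.
- rewrite -(inj_eq val_inj) /= ei ej eqn_add2l ltn_add2l.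
  by case: eqP; case: ifP => //=; rewrite ?mulr1 ?mulr0.
Qed.

Section GaloisRing.

Variables (p d : nat) (Rt : comUnitRingType) (F : finFieldType).
Variables (iota : {rmorphism 'Z_(p ^ 2) -> Rt}) (red : {rmorphism Rt -> F}).
Hypotheses (p_prime : prime p) (GR : is_galois_ring d iota red).

(** The non-units and the kernel of [red] are the same set, p Rt. Through determinants, this lets
    invertibility of matrices be tested mod p. *)
Lemma unitr_red (x : Rt) : (x \is a GRing.unit) = (red x != 0).
Proof.
apply/idP/idP => [|red0]; first by move/(rmorph_unit red); rewrite unitfE.
apply/negPn/negP => /(gr_local GR)/(gr_red_ker GR) red_x.
by rewrite red_x eqxx in red0.
Qed.

Lemma unitmx_red (m : nat) (M : 'M[Rt]_m) :
  (M \in unitmx) = (map_mx red M \in unitmx).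
Proof. by rewrite !unitmxE det_map_mx unitr_red unitfE. Qed.

Lemma red_p : red p%:R = 0.
Proof. by apply/(gr_red_ker GR); exists 1; rewrite mulr1. Qed.

(** By injectivity of [iota] it suffices to look in Z/p^2, where 0 < p < p^2. *)
Lemma natr_p_neq0 : (p%:R : Rt) != 0.
Proof.
have p_gt1 := prime_gt1 p_prime.
have p_lt : (p < p ^ 2)%N by rewrite -{1}(expn1 p) ltn_exp2l.
rewrite -(rmorph_nat iota) -(rmorph0 iota) (inj_eq (gr_iota_inj GR)).
rewrite -(inj_eq val_inj) /= val_Zp_nat ?(ltn_trans p_gt1) //.
by rewrite modn_small // -lt0n prime_gt0.
Qed.

(** Cancellation of p, valid only mod p: if [x - y] were nonzero mod p it would be a unit, and p (x
    - y) = 0 would force p = 0. *)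
Lemma mulp_inj_red (x y : Rt) : p%:R * x = p%:R * y -> red x = red y.
Proof.
move/eqP; rewrite -subr_eq0 -mulrBr => /eqP pxy.
apply/eqP; rewrite -subr_eq0 -rmorphB; apply: contraT; rewrite -unitr_red => u.
by have := natr_p_neq0; rewrite -(mulrK u p%:R) pxy mul0r eqxx.
Qed.

Lemma mulp_inj : injective (mulp GR).
Proof.
move=> y z; have [x /eqP <-] := gr_red_surj GR y.
have [x' /eqP <-] := gr_red_surj GR z.
by rewrite !mulp_red; apply: mulp_inj_red.
Qed.

Lemma mulp_mx_inj_red (m n : nat) (M N : 'M[Rt]_(m, n)) :
  p%:R *: M = p%:R *: N -> map_mx red M = map_mx red N.
Proof.
move=> /matrixP MN; apply/matrixP=> i j; have := MN i j; rewrite !mxE.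
exact: mulp_inj_red.
Qed.

Lemma red_mx_eq0_mulp (m n : nat) (M : 'M[Rt]_(m, n)) :
  map_mx red M = 0 -> exists N, M = p%:R *: N.
Proof.
move=> /matrixP M0.
(* The boolean equality allows [xchoose] to select all the quotients at once. *)
have MP i j : exists y, M i j == p%:R * y.
  have /(gr_red_ker GR)[y ->] : red (M i j) = 0 by have := M0 i j; rewrite !mxE.
  by exists y.
exists (\matrix_(i, j) xchoose (MP i j)); apply/matrixP=> i j; rewrite !mxE.
exact/eqP/(xchooseP (MP i j)).
Qed.

Lemma map_mulp_red (m n : nat) (N : 'M[Rt]_(m, n)) :
  map_mx (mulp GR) (map_mx red N) = p%:R *: N.
Proof. by apply/matrixP=> i j; rewrite !mxE mulp_red. Qed.

Lemma red_scale_p (m n : nat) (N : 'M[Rt]_(m, n)) : map_mx red (p%:R *: N) = 0.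
Proof. by rewrite map_mxZ /= red_p scale0r. Qed.

Lemma rank_red_smith_equiv (a k r1 : nat) (N : 'M[Rt]_k) (X Y : 'M[Rt]_(a + k)) :
  X \in unitmx -> Y \in unitmx -> (r1 <= k)%N ->
  X *m block_mx 1%:M 0 0 (p%:R *: N)
    = block_mx 1%:M 0 0 (p%:R *: pid_mx r1) *m Y ->
  \rank (map_mx red N) = r1.
Proof.
rewrite !unitmx_red => uX uY r1k.
rewrite -[X]submxK -[Y]submxK in uX uY *.
set X1 := ulsubmx X in uX *; set X2 := ursubmx X in uX *.
set X3 := dlsubmx X in uX *; set X4 := drsubmx X in uX *.
set Y1 := ulsubmx Y in uY *; set Y2 := ursubmx Y in uY *.
set Y3 := dlsubmx Y in uY *; set Y4 := drsubmx Y in uY *.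
rewrite !mulmx_block !mulmx1 !mulmx0 !mul1mx !mul0mx !addr0 !add0r.
(* The off-diagonal blocks give Y2 = p X2 N and X3 = p I Y3, with I = [pid_mx r1]; both vanish mod
   p, so the determinants of X and Y mod p factor through the diagonal blocks. *)
rewrite -!scalemxAr -!scalemxAl => /eq_block_mx[_ eY2 eX3 /mulp_mx_inj_red eq4].
move: uX uY; rewrite !map_block_mx eX3 -eY2 !red_scale_p !unitmxE.
rewrite det_ublock det_lblock !unitrM => /andP[_ uX4] /andP[_ uY4].
rewrite -(mxrank_mulmx_unit (map_mx red N) uX4 (unitmx1 _ _)) mulmx1.
rewrite -map_mxM eq4 map_mxM /= map_pid_mx -(mul1mx (pid_mx _)).
by rewrite mxrank_mulmx_unit ?unitmx1 // rank_pid_mx.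
Qed.

End GaloisRing.

Theorem lemma3p2 (p d : nat) (p_prime : prime p) (d_ge1 : (1 <= d)%N)
    (Rt : comUnitRingType) (F : finFieldType)
    (iota : {rmorphism 'Z_(p ^ 2) -> Rt}) (red : {rmorphism Rt -> F})
    (GR : is_galois_ring d iota red)
    (n : nat) (A : 'M['Z_(p ^ 2)]_n)
    (r0 r1 r2 : nat) (smithA : has_smith_form A r0 r1 r2)
    (a k : nat) (a_def : a = \rank (map_mx red (map_mx iota A)))
    (k_def : k = (n - a)%N) (n_split : n = (a + k)%N)
    (P Q A' : 'M[Rt]_n) (P_unit : P \in unitmx) (Q_unit : Q \in unitmx)
    (A'_def : A' = P *m map_mx iota A *m Q)
    (B : 'M[Rt]_a) (C : 'M[Rt]_(a, k)) (D : 'M[Rt]_(k, a)) (E : 'M[Rt]_k)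
    (A'_block : castmx (n_split, n_split) A' = block_mx B C D E)
    (B_nonsing : map_mx red B \in unitmx) :
  let J := E - D *m invmx B *m C in
  [/\ B \in unitmx,
      map_mx red J = 0,
      exists! T : 'M[F]_k, J = map_mx (mulp GR) T &
      forall T : 'M[F]_k, J = map_mx (mulp GR) T ->
        r1 = \rank T /\ r2 = (k - \rank T)%N].
Proof.
move=> J; subst n.
have [n_eq [U [V [uU uV UAV]]]] := smithA.
have uB : B \in unitmx by rewrite (unitmx_red GR).
have uiU : map_mx iota U \in unitmx by apply: map_mx_unit.
have uiV : map_mx iota V \in unitmx by apply: map_mx_unit.
have iS : map_mx iota U *m map_mx iota A *m map_mx iota V
          = map_mx iota (smith_diag p (a + k) r0 r1).
  by rewrite -!map_mxM UAV.
(* Mod p the Smith form becomes [pid_mx r0], and [U], [V] stay invertible, so the rank is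
   preserved. *)
have a_eq : a = r0.
  pose riota : {rmorphism 'Z_(p ^ 2) -> F} := red \o iota.
  rewrite a_def -(mxrank_mulmx_unit (X := map_mx red (map_mx iota U))
    (Y := map_mx red (map_mx iota V))) -?(unitmx_red GR) //.
  rewrite -!map_mxM UAV -map_mx_comp (map_smith_diag _ _ _ riota).
    by rewrite rank_pid_mx // n_eq -addnA leq_addr.
  by rewrite -(rmorph_nat red) (red_p GR).
subst r0.
have k_eq : k = (r1 + r2)%N by apply/eqP; rewrite -(eqn_add2l a) addnA -n_eq.
rewrite castmx_id in A'_block.
pose L := block_mx 1%:M 0 (D *m invmx B) 1%:M : 'M_(a + k).
pose W := block_mx B C 0 1%:M : 'M_(a + k).
have uL : L \in unitmx by rewrite unitmxE det_lblock !det1 mulr1 unitr1.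
have uW : W \in unitmx by rewrite unitmxE det_ublock det1 mulr1 -unitmxE.
have A'J : A' = L *m block_mx 1%:M 0 0 J *m W by rewrite A'_block block_mx_schur.
have redJ : map_mx red J = 0.
  (* Both sides are the rank of [A'] mod p: the left one from the factorization through diag(1, J),
     the right one from A' = P A Q. *)
  have : (a + \rank (map_mx red J) = a)%N.
    rewrite -{1}(mxrank1 F a) -rank_diag_block_mx.
    rewrite -(mxrank_mulmx_unit (X := map_mx red L) (Y := map_mx red W))
      -?(unitmx_red GR) //.
    rewrite -(map_mx1 red) -!(map_mx0 red) -map_block_mx -!map_mxM -A'J A'_def.
    by rewrite !map_mxM mxrank_mulmx_unit -?(unitmx_red GR).
  by rewrite -{2}[a]addn0 => /addnI/eqP; rewrite mxrank_eq0 => /eqP.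
have [N JN] := red_mx_eq0_mulp GR redJ.
(* Injectivity of [mulp] identifies every admissible [T] with N mod p, so the rank has to be
   computed only for N. *)
have T_uniq T : J = map_mx (mulp GR) T -> T = map_mx red N.
  rewrite JN -(map_mulp_red GR) => /matrixP eNT; apply/matrixP=> i j.
  by apply/esym/(mulp_inj p_prime (GR := GR)); have := eNT i j; rewrite !mxE.
have rkN : \rank (map_mx red N) = r1.
  (* With S = U A V, solving P A Q = L diag(1, J) W for A and substituting gives U P^-1 L diag(1, J)
     = S V^-1 Q W^-1; [X] and [Y] are the outer factors. *)
  pose X := map_mx iota U *m invmx P *m L.
  pose Y := invmx (map_mx iota V) *m Q *m invmx W.
  apply: (rank_red_smith_equiv p_prime GR (X := X) (Y := Y)).
  - by rewrite !unitmx_mul uiU unitmx_inv P_unit.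
  - by rewrite !unitmx_mul !unitmx_inv uiV uW Q_unit.
  - by rewrite k_eq leq_addr.
  have -> : block_mx 1%:M 0 0 (p%:R *: pid_mx r1)
            = map_mx iota (smith_diag p (a + k) a r1).
    by rewrite smith_diag_block map_block_mx map_mxZ /= rmorph_nat map_pid_mx
               map_mx1 !map_mx0.
  rewrite -iS -JN /X /Y -!mulmxA (mulKVmx uiV) !mulmxA.
  (* Multiplying on the right by [W] restores the product L diag(1, J) W = A'. *)
  apply: (can_inj (mulmxK uW)); rewrite mulmxKV //.
  by rewrite -!mulmxA (mulmxA L) -A'J A'_def !mulmxA mulmxKV.
split=> //; first exists (map_mx red N).
  by split=> [|T /T_uniq //]; rewrite map_mulp_red.
by move=> T /T_uniq ->; rewrite rkN k_eq addKn.
Qed.
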